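(* Let $n\in\mathbb N$, let $\boldsymbol{x}=(x_1,\ldots,x_n)$, $\boldsymbol{y}=(y_1,\ldots,y_n)$, $\mathbf{s}=(s_1,\ldots,s_n)$, $\boldsymbol{t}=(t_1,\ldots,t_n)$ be sequences of non-zero parameters, let $z_0$ be a further non-zero parameter, and put $\boldsymbol{z}=(s_1x_1,\ldots,s_nx_n,z_0,t_1y_1^{-1},\ldots,t_ny_n^{-1})$. Let $\delta=(n,n-1,\ldots,1)$, let $\mu$ be a partition with at most $n$ non-zero parts, $\lambda=\mu+\delta$ and $m=\lambda_1$ (so $m\ge n$). For $A\in\mathcal B'^\lambda_n$ with compass point matrix $C=(c_{ij})$ define $$\mathrm{wgt}(A)=\prod_{i=1}^n y_i^{\,n-m-i}\prod_{i=1}^{2n+1}\prod_{j=1}^m \mathrm{wgt}(c_{ij}),$$ where, for a row $i<n+1$: $\mathrm{wgt}(\mathrm{WE})=y_i$, $\mathrm{wgt}(\mathrm{NS})=1+s_ix_it_iy_i^{-1}$, $\mathrm{wgt}(\mathrm{NE})=t_i$, $\mathrm{wgt}(\mathrm{SE})=1$, $\mathrm{wgt}(\mathrm{NW})=y_i$, $\mathrm{wgt}(\mathrm{SW})=s_ix_i$; for the row $i=n+1$: $\mathrm{wgt}(\mathrm{WE})=1$, $\mathrm{wgt}(\mathrm{NS})=1+z_0^2$, $\mathrm{wgt}(\mathrm{NE})=z_0$, $\mathrm{wgt}(\mathrm{SE})=1$, $\mathrm{wgt}(\mathrm{NW})=1$, $\mathrm{wgt}(\mathrm{SW})=z_0$;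 and for a row $i>n+1$, writing $k=2n+2-i$: $\mathrm{wgt}(\mathrm{WE})=y_k$, $\mathrm{wgt}(\mathrm{NS})=1+s_kx_kt_ky_k^{-1}$, $\mathrm{wgt}(\mathrm{NE})=s_kx_k$, $\mathrm{wgt}(\mathrm{SE})=y_k$, $\mathrm{wgt}(\mathrm{NW})=1$, $\mathrm{wgt}(\mathrm{SW})=t_k$. Then $$\sum_{A\in\mathcal B'^\delta_n}\mathrm{wgt}(A)=\prod_{i=1}^n(1+z_0s_ix_i)\prod_{1\le i<j\le n}(1+s_is_jx_ix_j)(1+s_it_jx_iy_j^{-1}),$$ and there is a function $\Phi^\mu_{B'_n}$ of $2n+1$ variables, invariant under all permutations of its $2n+1$ arguments, such that $$\sum_{A\in\mathcal B'^\lambda_n}\mathrm{wgt}(A)=\sum_{A\in\mathcal B'^\delta_n}\mathrm{wgt}(A)\;\Phi^\mu_{B'_n}(\boldsymbol{z}).$$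
   Context: Fix $n\ge1$ and $N=2n+1$. For a strict partition $\lambda=(\lambda_1>\lambda_2>\cdots>\lambda_n>0)$ with $m=\lambda_1\ge n$, a $\lambda$-HTSASM (odd type) is an $N\times m$ matrix $A=(a_{ij})$ with entries in $\{0,1,-1\}$ such that, with $\varepsilon_i=1$ if $i=n+1$ and $\varepsilon_i=0$ otherwise: (i) $\sum_{k=j}^m a_{ik}\in\{0,1\}$ for all $i$ and $1\le j\le m$; (ii) $\sum_{k=1}^m a_{ik}+\varepsilon_i+\sum_{k=1}^j a_{N+1-i,k}\in\{0,1\}$ for all $i$ and $0\le j\le m$; (iii) $\sum_{k=1}^i a_{kj}\in\{0,1\}$ for all $i,j$; (iv) $\sum_{j=1}^m(a_{ij}+a_{N+1-i,j})+\varepsilon_i=1$ for all $i$; (v) $\sum_{i=1}^N a_{ij}=1$ if $j\in\{\lambda_1,\ldots,\lambda_n\}$ and $=0$ otherwise. (This is the right-hand portion of a half-turn symmetric alternating-sign-type array whose central column has a single $1$ at the centre, row $i$ continuing via a U-turn into row $N+1-i$.) The set of these is $\mathcal B'^\lambda_n$. The compass point matrix $C=(c_{ij})$ of $A$ is the $N\times m$ matrix with entries in $\{\mathrm{WE},\mathrm{NS},\mathrm{NE},\mathrm{SE},\mathrm{NW},\mathrm{SW}\}$ defined as follows: let $\alpha_{ij}=\sum_{k<i}a_{kj}$ and $r_{ij}=\sum_{k>j}a_{ik}$ (both in $\{0,1\}$); $c_{ij}=\mathrm{WE}$ if $a_{ij}=1$, $c_{ij}=\mathrm{NS}$ if $a_{ij}=-1$,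 and if $a_{ij}=0$ then $c_{ij}=\mathrm{SE},\mathrm{NE},\mathrm{SW},\mathrm{NW}$ according as $(\alpha_{ij},r_{ij})=(0,0),(1,0),(0,1),(1,1)$. *)

(* Defs.v *)
From mathcomp Require Import all_boot all_order all_fingroup all_algebra.
Set Implicit Arguments.
Unset Strict Implicit.
Unset Printing Implicit Defensive.
Import GRing.Theory.
Local Open Scope ring_scope.

(* Indices are 0-based ordinals. The number of rows N = 2n+1 is written n+1+n,
   so that [split] separates the n upper rows, the central row and the n lower
   rows; [rev_ord] sends row i to row N+1-i. *)

Definition add_staircase n (mu : n.-tuple nat) : n.-tuple nat :=
  [tuple (tnth mu i + (n - i))%N | i < n].

Definition staircase n : n.-tuple nat := [tuple (n - i)%N | i < n].

Definition zero_or_one (a : int) : bool := (a == 0) || (a == 1).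

Definition sign_entry := seq_sub [:: 0; 1; -1 : int].

Section HTSASM.
Variables (n m : nat) (lam : n.-tuple nat) (A : 'M[int]_(n + 1 + n, m)).

Definition eps (i : 'I_(n + 1 + n)) : int := (i == n :> nat)%:R.

Definition is_htsasm : bool :=
  [&& [forall i, forall j : 'I_m,
         zero_or_one (\sum_(k < m | (j <= k)%N) A i k)],
      [forall i, forall j : 'I_m.+1,
         zero_or_one (\sum_k A i k + eps i
                      + \sum_(k < m | (k < j)%N) A (rev_ord i) k)],
      [forall i : 'I_(n + 1 + n), forall j,
         zero_or_one (\sum_(k < n + 1 + n | (k <= i)%N) A k j)],
      [forall i, \sum_j (A i j + A (rev_ord i) j) + eps i == 1]
    & [forall j, \sum_i A i j == (j.+1 \in lam)%:R]].

End HTSASM.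

(* The number of columns is the largest part of lam, i.e. its head. *)
Definition htsasms n (lam : n.-tuple nat) :
    {set 'M[sign_entry]_(n + 1 + n, head 0%N lam)} :=
  [set A | is_htsasm lam (map_mx val A)].

Inductive compass_point := WE | NS | NE | SE | NW | SW.

(* On an HTSASM the partial sums north and east of (i, j) are 0 or 1. *)
Definition compass n m (A : 'M[int]_(n + 1 + n, m))
    (i : 'I_(n + 1 + n)) (j : 'I_m) : compass_point :=
  let north := \sum_(k < n + 1 + n | (k < i)%N) A k j in
  let east := \sum_(k < m | (j < k)%N) A i k in
  if A i j == 1 then WE else if A i j == -1 then NS
  else if north == 0 then (if east == 0 then SE else SW)
  else (if east == 0 then NE else NW).

Section Weight.
Variables (F : fieldType) (n : nat) (x y s t : 'I_n -> F) (z0 : F).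

Definition upper_wgt (k : 'I_n) (c : compass_point) : F :=
  match c with
  | WE => y k
  | NS => 1 + s k * x k * t k * (y k)^-1
  | NE => t k
  | SE => 1
  | NW => y k
  | SW => s k * x k
  end.

Definition central_wgt (c : compass_point) : F :=
  match c with
  | WE => 1
  | NS => 1 + z0 ^+ 2
  | NE => z0
  | SE => 1
  | NW => 1
  | SW => z0
  end.

Definition lower_wgt (k : 'I_n) (c : compass_point) : F :=
  match c with
  | WE => y k
  | NS => 1 + s k * x k * t k * (y k)^-1
  | NE => s k * x k
  | SE => y k
  | NW => 1
  | SW => t k
  end.

(* The lower row in (1-based) position i carries the parameters of index
   2n+2-i, whence the [rev_ord]. *)
Definition row_wgt (i : 'I_(n + 1 + n)) : compass_point -> F :=
  match split i with
  | inl i' => match split i' with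
              | inl k => upper_wgt k
              | inr _ => central_wgt
              end
  | inr k => lower_wgt (rev_ord k)
  end.

(* The exponent of y_i is n - m - i, an integer, with i 1-based. *)
Definition wgt m (A : 'M[int]_(n + 1 + n, m)) : F :=
  (\prod_(i < n) y i ^ (n%:Z - m%:Z - (i.+1)%:Z))
  * \prod_i \prod_j row_wgt i (compass A i j).

Definition htsasm_sum (lam : n.-tuple nat) : F :=
  \sum_(A in htsasms lam) wgt (map_mx val A).

Definition zvec : 'rV[F]_(n + 1 + n) :=
  row_mx (row_mx (\row_i (s i * x i)) (const_mx z0)) (\row_i (t i * (y i)^-1)).

Definition nonzero_params : Prop :=
  (forall i, [/\ x i != 0, y i != 0, s i != 0 & t i != 0]) /\ z0 != 0.

End Weight.

(* Main.v *)
From HB Require Import structures.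
Require Import Defs.
From mathcomp Require Import all_boot all_order all_fingroup all_algebra.
From mathcomp Require Import ring zify.
Set Implicit Arguments.
Unset Strict Implicit.
Unset Printing Implicit Defensive.
Import GRing.Theory.
Local Open Scope ring_scope.

(** The powers of y_i cancel, and with z_i = s_i x_i, w_i = t_i / y_i the weights
    become those of a free-fermionic six-vertex model: a row with parameters
    (u, w) weighs WE, NS, NE, SE, NW, SW by 1, 1 + u w, w, 1, 1, u, where (u, w)
    is (z_i, w_i) in row i, (z_0, z_0) in the centre and (w_i, z_i) in row
    2n+2-i. On the fermionic Fock space of the columns, a row of sum 0 intertwines
    the creation operator of a series f with that of (w + X) / (1 - u X) f, and a
    row of sum 1 is that row followed by the creation operator of 1 / (1 - u X).
    Summing over the way each pair of rows shares its entry sum 1 therefore gives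
    a wedge product of n vectors p_k / D, where D is the product of 1 - u X over
    all 2n+1 variables, hence symmetric. Each p_k is 1 + X^2 times a form of
    degree n - 1 in V = 1 - X^2 and X, so the wedge is a scalar multiple of that of
    the fixed vectors (1 + X^2) V^(n-1-i) X^i / D. The scalar is computed by
    induction on n: all p_k but the first are multiples of
    (1 - z_1 X) (z_1 + X) = z_1 V + (1 - z_1^2) X, so only the value of the first
    form at the zero (V, X) = (1 - z_1^2, - z_1) of this factor matters. For the
    staircase the wedge of the fixed vectors is unitriangular. *)

Section Fock.
Variable R : comNzRingType.

(** * Row transfer on the Fock space of the columns *)

(* fock k.+1 splits a state by the occupation of the first column: empty, full. *)
Fixpoint fock m : lmodType R :=
  if m is k.+1 then (fock k * fock k)%type : lmodType R else R^o.

(* The sign is that of moving past an occupied first column. *)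
Fixpoint create m (f : nat -> R) : fock m -> fock m :=
  if m is k.+1 then
    fun p : fock k * fock k =>
      (create (fun i => f i.+1) p.1, f 0%N *: p.1 - create (fun i => f i.+1) p.2)
  else fun=> 0.

(* One row of the model; l is the state of its west edge, the sum of its entries. *)
Fixpoint transfer m (u w : R) (l : bool) : fock m -> fock m :=
  if m is k.+1 then
    fun p : fock k * fock k =>
      if l then (u *: transfer u w true p.1,
                 transfer u w false p.1 + transfer u w true p.2)
      else (transfer u w false p.1 + (1 + u * w) *: transfer u w true p.2,
            w *: transfer u w false p.2)
  else fun x => if l then 0 else x.

Fixpoint vacuum m : fock m := if m is k.+1 then (vacuum k, 0) else 1.

Lemma create_is_linear m f : linear (@create m f).
Proof.
elim: m f => [|m IH] f a x y /=; first by rewrite scaler0 addr0.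
rewrite !IH; congr pair.
rewrite -[RHS]/(a *: (_ *: x.1 - create _ x.2) + (_ *: y.1 - create _ y.2)).
by rewrite scalerDr scalerBr !scalerA [f 0%N * a]mulrC opprD addrACA.
Qed.
HB.instance Definition _ m f :=
  GRing.isLinear.Build R (fock m) (fock m) _ (@create m f) (create_is_linear f).

Lemma transfer_is_linear m u w l : linear (@transfer m u w l).
Proof.
elim: m l => [|m IH] [] a x y //=; first by rewrite scaler0 addr0.
- rewrite !IH; congr pair.
    by rewrite scalerDr !scalerA [u * a]mulrC -scalerA.
  by rewrite -[RHS]/(a *: (_ + _) + (_ + _)) scalerDr addrACA.
- rewrite !IH; congr pair.
    rewrite -[RHS]/(a *: (_ + _ *: _) + (_ + _ *: _)).
    by rewrite !scalerDr !scalerA [a * _]mulrC addrACA.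
  by rewrite scalerDr !scalerA [w * a]mulrC -scalerA.
Qed.
HB.instance Definition _ m u w l :=
  GRing.isLinear.Build R (fock m) (fock m) _ (@transfer m u w l)
    (transfer_is_linear u w l).

Lemma eq_create m f g (x : fock m) :
  (forall i, (i < m)%N -> f i = g i) -> create f x = create g x.
Proof.
elim: m f g x => [//|m IH] f g x efg /=.
by rewrite (efg 0%N) // !(IH _ (fun i => g i.+1)) // => i im; rewrite efg.
Qed.

Lemma create_lin m a f g (x : fock m) :
  create (fun i => a * f i + g i) x = a *: create f x + create g x.
Proof.
elim: m f g x => [|m IH] f g x /=; first by rewrite scaler0 addr0.
rewrite !IH; congr pair.
by rewrite scalerDl opprD addrACA /= -scalerN -scalerA -scalerDr.
Qed.

Lemma create_anticomm m f g (x : fock m) :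
  create f (create g x) = - create g (create f x).
Proof.
elim: m f g x => [|m IH] f g x /=; first by rewrite oppr0.
congr pair; first exact: IH.
rewrite !raddfB /= !linearZ /= [create _ (create _ x.2)]IH.
by rewrite !scalerN !opprK addrCA.
Qed.

Lemma create_sqr m f (x : fock m) : create f (create f x) = 0.
Proof.
elim: m f x => [//|m IH] f x /=; congr pair; first exact: IH.
by rewrite raddfB /= linearZ /= IH subr0 subrr.
Qed.

(** Induction on the columns. In a full first column the creation operator brings [- u * w], which
    cancels against the [NS] weight [1 + u * w] and leaves the weight 1 of [NW]: this is the
    free-fermion condition. *)
Lemma transferT m u w (x : fock m) :
  transfer u w true x = create (fun i => u ^+ i) (transfer u w false x).
Proof.
elim: m x => [//|m IH] x /=.
have shift y : create (fun i => u ^+ i.+1) y = u *: create (fun i => u ^+ i) y :> fock m.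
  rewrite -[RHS]addr0 -(_ : create (fun=> 0) y = 0); last first.
    elim: (m) y => //= k IHk y; rewrite !IHk subr0 scale0r //.
  by rewrite -create_lin; apply: eq_create => i _; rewrite addr0 exprS.
rewrite !shift raddfD /= !linearZ /= !IH create_sqr scaler0 addr0; congr pair.
rewrite expr0 scale1r -addrA; congr (_ + _).
by rewrite !scalerN scalerDl scale1r scalerA addrK.
Qed.

(* The coefficients of (w + X) / (1 - u X) f. *)
Fixpoint quotient_series (u w : R) (f : nat -> R) (i : nat) : R :=
  if i is k.+1 then u * quotient_series u w f k + w * f i + f k else w * f 0%N.

(** From (w + X) / (1 - u X) = w + (1 + u w) X / (1 - u X), applied to f = f_0 + X f'. *)
Lemma quotient_seriesS u w f i :
  quotient_series u w f i.+1
  = (1 + u * w) * f 0%N * u ^+ i + quotient_series u w (fun i => f i.+1) i.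
Proof.
elim: i => [|i IH]; first by rewrite /= expr0; ring.
by rewrite [LHS]/= -/(quotient_series u w f i.+1) IH /= exprS; ring.
Qed.

(** Peeling the first column splits the series into a geometric part and a shifted part. By
    [transferT] the geometric part is what turns a row of sum 0 into one of sum 1, and applied twice
    it vanishes; the shifted part is the induction hypothesis. *)
Lemma transferF_create m u w f (x : fock m) :
  transfer u w false (create f x)
  = create (quotient_series u w f) (transfer u w false x).
Proof.
elim: m f x => [//|m IH] f x /=.
have shift y : create (fun i => u * quotient_series u w f i + w * f i.+1 + f i) y
   = ((1 + u * w) * f 0%N) *: create (fun i => u ^+ i) y
     + create (quotient_series u w (fun i => f i.+1)) y :> fock m.
  rewrite -create_lin; apply: eq_create => i _.
  by rewrite -quotient_seriesS.
rewrite !shift !transferT !raddfB !raddfD /= !linearZ /= !IH.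
rewrite create_sqr !scaler0 addr0; congr pair.
  rewrite scalerA [f 0%N * _]mulrC addrCA -create_anticomm.
  by [].
rewrite !scalerN !scalerA [f 0%N * w]mulrC [w * f 0%N in X in _ + X *: _ + _]mulrC mulrA.
by rewrite addrA addrK.
Qed.

(** * Creation operators of polynomials modulo X^m *)

Definition eqX m (p q : {poly R}) := forall i, (i < m)%N -> p`_i = q`_i.

Lemma eqX_trans m p q r : eqX m p q -> eqX m q r -> eqX m p r.
Proof. by move=> pq qr i im; rewrite pq ?qr. Qed.

Lemma eqX_mull m a p q : eqX m p q -> eqX m (a * p) (a * q).
Proof.
move=> pq i im; rewrite !coefM; apply: eq_bigr => j _.
by rewrite pq // (leq_ltn_trans (leq_subr _ _)).
Qed.

(** The inverse of 1 - u X modulo X^m. *)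
Definition geom m (u : R) : {poly R} := \poly_(i < m) u ^+ i.

Lemma geom_mul m u : eqX m ((1 - u%:P * 'X) * geom m u) 1.
Proof.
move=> [|i] im; rewrite mulrBl mul1r coefB -mulrA coefCM coefXM !coef_poly im.
  by rewrite mulr0 subr0 coef1.
by rewrite (ltnW im) exprS subrr coef1.
Qed.

Definition create_poly m (p : {poly R}) : fock m -> fock m :=
  create (fun i => p`_i).

Lemma eq_create_poly m p q (x : fock m) :
  eqX m p q -> create_poly p x = create_poly q x.
Proof. by move=> pq; apply: eq_create. Qed.

Lemma create_polyD m p q (x : fock m) :
  create_poly (p + q) x = create_poly p x + create_poly q x.
Proof.
rewrite -[create_poly p x]scale1r -create_lin; apply: eq_create => i _.
by rewrite coefD mul1r.
Qed.

Lemma create_polyZ m a p (x : fock m) :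
  create_poly (a%:P * p) x = a *: create_poly p x.
Proof.
have c0 : create_poly 0 x = 0.
  by apply: (@addrI _ (create_poly 0 x)); rewrite -create_polyD !addr0.
rewrite -[RHS]addr0 -c0 -create_lin; apply: eq_create => i _.
by rewrite coefCM coef0 addr0.
Qed.

Lemma create_poly_linear m p : linear (@create_poly m p).
Proof. exact: linearP. Qed.
HB.instance Definition _ m p :=
  GRing.isLinear.Build R (fock m) (fock m) _ (@create_poly m p)
    (create_poly_linear p).

Lemma create_poly_anticomm m p q (x : fock m) :
  create_poly p (create_poly q x) = - create_poly q (create_poly p x).
Proof. exact: create_anticomm. Qed.

Lemma create_poly_sqr m p (x : fock m) : create_poly p (create_poly p x) = 0.
Proof. exact: create_sqr. Qed.

Lemma transferT_poly m u w (x : fock m) :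
  transfer u w true x = create_poly (geom m u) (transfer u w false x).
Proof. by rewrite transferT; apply: eq_create => i im; rewrite coef_poly im. Qed.

Lemma transferF_poly m u w p (x : fock m) :
  transfer u w false (create_poly p x)
  = create_poly ((w%:P + 'X) * geom m u * p) (transfer u w false x).
Proof.
rewrite transferF_create; apply: eq_create => i im.
set q := _ * _ * p.
(* Clearing the denominator 1 - u X gives the recurrence that defines [quotient_series]. *)
have qE j : (j < m)%N -> ((1 - u%:P * 'X) * q)`_j = ((w%:P + 'X) * p)`_j.
  move=> jm; rewrite (_ : _ * q = (w%:P + 'X) * p * ((1 - u%:P * 'X) * geom m u)).
    by rewrite (eqX_mull _ (@geom_mul m u)) ?mulr1.
  by rewrite /q; ring.
elim: i im => [|i IH] im.
  have := qE _ im; rewrite mulrBl mulrDl coefB coefD mul1r -mulrA !coefCM !coefXM.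
  by rewrite /= mulr0 subr0 addr0.
have := qE _ im; rewrite mulrBl mulrDl coefB coefD mul1r -mulrA !coefCM !coefXM.
by move=> /= /eqP; rewrite subr_eq => /eqP ->; rewrite IH ?(ltnW im) //; ring.
Qed.

Fixpoint wedge m (g : {poly R}) (ps : seq {poly R}) (x : fock m) : fock m :=
  if ps is p :: ps' then create_poly (g * p) (wedge g ps' x) else x.

Lemma wedge_map m g h ps (x : fock m) :
  wedge g [seq h * p | p <- ps] x = wedge (g * h) ps x.
Proof. by elim: ps => //= p ps ->; rewrite mulrA. Qed.

Lemma eq_wedge m g h ps (x : fock m) : eqX m g h -> wedge g ps x = wedge h ps x.
Proof.
move=> gh; elim: ps => //= p ps ->; apply: eq_create_poly.
by rewrite ![_ * p]mulrC; apply: eqX_mull.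
Qed.

Lemma wedge_create m g ps q (x : fock m) :
  wedge g ps (create_poly q x) = (-1) ^+ size ps *: create_poly q (wedge g ps x).
Proof.
elim: ps => [|p ps IH] /=; first by rewrite expr0 scale1r.
by rewrite IH linearZ /= create_poly_anticomm scalerN exprS mulN1r scaleNr.
Qed.

Lemma transfer_wedge m u w g ps (x : fock m) :
  transfer u w false (wedge g ps x)
  = wedge ((w%:P + 'X) * geom m u * g) ps (transfer u w false x).
Proof. by elim: ps => //= p ps IH; rewrite transferF_poly IH mulrA. Qed.

(** * Pairs of rows nested around the central row *)

Section Nest.
Variable z0 : R.
Implicit Types (ps : seq (R * R)).

(* Rows i and 2n+2-i for each (z_i, w_i) in ps, around the central row; the two
   summands are the two ways of sharing the entry sum 1 of such a pair. *)
Fixpoint nest m ps : fock m -> fock m :=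
  if ps is (z, w) :: ps' then fun x =>
    transfer w z true (nest ps' (transfer z w false x))
    + transfer w z false (nest ps' (transfer z w true x))
  else transfer z0 z0 false.

(** What remains of [nest] once every creation operator is pulled out to the left; it fixes the
    vacuum. *)
Fixpoint nest0 m ps : fock m -> fock m :=
  if ps is (z, w) :: ps' then fun x =>
    transfer w z false (nest0 ps' (transfer z w false x))
  else transfer z0 z0 false.

Fixpoint num ps : {poly R} :=
  if ps is (z, w) :: ps' then (z%:P + 'X) * (w%:P + 'X) * num ps'
  else z0%:P + 'X.

Fixpoint den ps : {poly R} :=
  if ps is (z, w) :: ps' then
    (1 - z%:P * 'X) * (1 - w%:P * 'X) * den ps'
  else 1 - z0%:P * 'X.

Fixpoint inv_den m ps : {poly R} :=
  if ps is (z, w) :: ps' then geom m z * geom m w * inv_den m ps'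
  else geom m z0.

(** Numerator, over the common denominator, of the vector created by the outermost pair: the first
    term arises when its lower row has sum 1, the second when its upper row has. The sign is that of
    moving past the [size ps] inner vectors. *)
Definition pivot z ps : {poly R} :=
  (1 - z%:P * 'X) * den ps + (-1) ^+ size ps * ((z%:P + 'X) * num ps).

Fixpoint numerators ps : seq {poly R} :=
  if ps is (z, w) :: ps' then
    pivot z ps' ::
      [seq (1 - z%:P * 'X) * (z%:P + 'X) * p | p <- numerators ps']
  else [::].

Lemma size_numerators ps : size (numerators ps) = size ps.
Proof. by elim: ps => // [[z w] ps] /= IH; rewrite size_map IH. Qed.

Lemma inv_denP m ps : eqX m (den ps * inv_den m ps) 1.
Proof.
elim: ps => [|[z w] ps IH] /=; first exact: geom_mul.
set d := den ps in IH *; set e := inv_den m ps in IH *.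
rewrite [X in eqX _ X _](_ : _ = (1 - z%:P * 'X) * geom m z * (d * e)
   * ((1 - w%:P * 'X) * geom m w)); last by ring.
apply: eqX_trans (eqX_mull _ (@geom_mul m w)) _; rewrite mulr1.
by apply: eqX_trans (eqX_mull _ IH) _; rewrite mulr1; apply: geom_mul.
Qed.

Lemma nest0_create m ps p (x : fock m) :
  nest0 ps (create_poly p x)
  = create_poly (num ps * inv_den m ps * p) (nest0 ps x).
Proof.
elim: ps p x => [|[z w] ps IH] p x /=; first exact: transferF_poly.
rewrite transferF_poly IH transferF_poly; congr create_poly; ring.
Qed.

(** In both summands the inner wedge passes through the lower row of sum 0, which multiplies its
    vectors by (z + X) / (1 - w X). The two summands thus differ only in the created vector, and
    creation is linear in that vector. *)
Lemma nestE m ps (x : fock m) :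
  nest ps x = wedge (inv_den m ps) (numerators ps) (nest0 ps x).
Proof.
elim: ps x => [|[z w] ps IH] x //=.
rewrite !IH transferT_poly !transfer_wedge transferT_poly nest0_create.
rewrite transferF_poly wedge_create size_numerators -create_polyZ -create_polyD.
set g := (z%:P + 'X) * _ * inv_den m ps; set y := transfer w z false _.
rewrite wedge_map.
(* The inner vectors have no denominator 1 - z X, so extending them to the common denominator costs
   the factor 1 - z X. *)
have gE : eqX m (inv_den m ((z, w) :: ps) * ((1 - z%:P * 'X) * (z%:P + 'X))) g.
  rewrite [X in eqX _ X _](_ : _ = g * ((1 - z%:P * 'X) * geom m z)); last first.
    by rewrite /g /=; ring.
  by apply: eqX_trans (eqX_mull _ (@geom_mul m z)) _; rewrite mulr1.
rewrite (eq_wedge _ _ gE); apply/esym/eq_create_poly; rewrite /pivot mulrDr.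
move=> i im; rewrite !coefD; congr (_ + _).
  transitivity ((geom m w * (den ps * inv_den m ps) *
    ((1 - z%:P * 'X) * geom m z))`_i); last first.
    rewrite (eqX_mull _ (@geom_mul m z)) // mulr1.
    by rewrite (eqX_mull _ (@inv_denP m ps)) // mulr1.
  by apply: (congr1 (fun p : {poly R} => p`_i)) => /=; ring.
by rewrite /= rmorphXn rmorphN1; apply: (congr1 (fun p : {poly R} => p`_i)); ring.
Qed.

Lemma nest0_vacuum m ps : nest0 ps (vacuum m) = vacuum m.
Proof.
have tv u w : transfer u w false (vacuum m) = vacuum m.
  by elim: m => //= m ->; rewrite !linear0 addr0.
by elim: ps => [|[z w] ps IH] /=; rewrite ?tv ?IH ?tv.
Qed.

End Nest.

(** * Wedge products of forms *)

Definition one_plus_sqrX : {poly R} := 1 + 'X ^+ 2.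
Definition one_minus_sqrX : {poly R} := 1 - 'X ^+ 2.

Definition form_basis n i : {poly R} := one_plus_sqrX * one_minus_sqrX ^+ i * 'X^(n - i).

(* p is 1 + X^2 times a form of degree n in V = 1 - X^2 and X, and a is the value of
   that form at (V, X) = (1 - z^2, - z); stated inductively to avoid dividing. *)
Inductive form_value z n : {poly R} -> R -> Prop :=
| form_value_basis i of (i <= n)%N :
    form_value z n (form_basis n i) ((1 - z ^+ 2) ^+ i * (- z) ^+ (n - i))
| form_value_add p q a b of form_value z n p a & form_value z n q b :
    form_value z n (p + q) (a + b)
| form_value_scale c p a of form_value z n p a :
    form_value z n (c%:P * p) (c * a).

Lemma form_value_eq z n p q a b :
  form_value z n p a -> p = q -> a = b -> form_value z n q b.
Proof. by move=> ? <- <-. Qed.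

Lemma form_valueX z n p a :
  form_value z n p a -> form_value z n.+1 ('X * p) (- z * a).
Proof.
elim=> [i le_in|{}p q {}a b _ fp _ fq|c {}p {}a _ fp].
- apply: form_value_eq (form_value_basis z (leqW le_in)) _ _;
    rewrite /form_basis ?subSn // ?[_ ^+ (n - i).+1]exprS; ring.
- by rewrite !mulrDr; apply: form_value_add.
- by rewrite mulrCA [- z * _]mulrCA; apply: form_value_scale.
Qed.

Lemma form_valueV z n p a :
  form_value z n p a -> form_value z n.+1 (one_minus_sqrX * p) ((1 - z ^+ 2) * a).
Proof.
elim=> [i le_in|{}p q {}a b _ fp _ fq|c {}p {}a _ fp].
- apply: form_value_eq (form_value_basis z (_ : i.+1 <= n.+1)%N) _ _ => //;
    rewrite /form_basis ?subSS [_ ^+ i.+1]exprS; ring.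
- by rewrite !mulrDr; apply: form_value_add.
- by rewrite mulrCA [(1 - _) * (_ * _)]mulrCA; apply: form_value_scale.
Qed.

(* The pivot obtained when the denominator is replaced by a monomial X^j. *)
Definition pivot_mono z n j : {poly R} :=
  (1 - z%:P * 'X) * 'X^j
  + (-1) ^+ n * ((z%:P + 'X) * ((-1) ^+ j * 'X^(n.*2.+1 - j))).

Lemma pivot_monoX z n j :
  (j <= n.*2.+1)%N -> pivot_mono z n.+1 j.+1 = 'X * pivot_mono z n j.
Proof.
move=> jn; rewrite /pivot_mono doubleS !subSS subSn // !exprS; ring.
Qed.

Lemma pivot_monoV z n j : (j <= n.*2.+1)%N ->
  one_minus_sqrX * pivot_mono z n j = pivot_mono z n.+1 j - pivot_mono z n.+1 j.+2.
Proof.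
move=> jn; rewrite /pivot_mono doubleS !subSS.
have -> : (n.*2.+3 - j = (n.*2.+1 - j).+2)%N by do 2![rewrite subSn ?(leqW jn) //].
by rewrite /one_minus_sqrX !exprS; ring.
Qed.

(** Induction on n: interior exponents are X times a case of lower degree, and the extreme exponents
    0 and 2n+1 are reached from interior ones through [pivot_monoV]. The values agree since (1 -
    z^2) + z^2 = 1. *)
Lemma pivot_mono_form z n j :
  (j <= n.*2.+1)%N -> form_value z n (pivot_mono z n j) ((- z) ^+ j).
Proof.
elim: n j => [|n IH] j jn.
  have f0 := form_value_basis z (leqnn 0).
  case: j jn => [|[|//]] _.
    by apply: form_value_eq f0 _ _; rewrite /form_basis /pivot_mono /one_plus_sqrX /=; ring.
  apply: form_value_eq (form_value_scale (- z) f0) _ _; last by rewrite /=; ring.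
  by rewrite /form_basis /pivot_mono /one_plus_sqrX /= rmorphN; ring.
have mid i : (i <= n.*2.+1)%N ->
    form_value z n.+1 (pivot_mono z n.+1 i.+1) ((- z) ^+ i.+1).
  by move=> im; rewrite pivot_monoX // exprS; apply/form_valueX/IH.
case: j jn => [|j] jn.
  have f := form_value_add (form_valueV (IH 0%N isT)) (mid 1%N isT).
  apply: form_value_eq f _ _; last by rewrite !exprS; ring.
  by rewrite pivot_monoV // subrK.
have [|jn'] := leqP j n.*2.+1; first exact: mid.
have -> : j = n.*2.+2 by apply/eqP; rewrite eqn_leq jn' andbT.
have f := form_value_add (mid n.*2 (leqnSn _))
  (form_value_scale (-1) (form_valueV (IH n.*2.+1 (leqnn _)))).
apply: form_value_eq f _ _; last by rewrite !exprS; ring.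
by rewrite pivot_monoV // polyCN polyC1; ring.
Qed.

(* The linear map p(X) |-> X^d p(-1/X) on polynomials of degree at most d, which
   sends the product of the 1 - a X to that of the a + X. *)
Inductive reflected : nat -> {poly R} -> {poly R} -> Prop :=
| reflected_mono d j of (j <= d)%N :
    reflected d 'X^j ((-1) ^+ j * 'X^(d - j))
| reflected_add d p q p' q' of reflected d p p' & reflected d q q' :
    reflected d (p + q) (p' + q')
| reflected_scale d c p p' of reflected d p p' :
    reflected d (c%:P * p) (c%:P * p').

Lemma reflected_eq d e p q p' q' :
  reflected d p p' -> d = e -> p = q -> p' = q' -> reflected e q q'.
Proof. by move=> ? <- <- <-. Qed.

Lemma reflected_mul d a p p' : reflected d p p' ->
  reflected d.+1 ((1 - a%:P * 'X) * p) ((a%:P + 'X) * p').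
Proof.
elim=> {d p p'} [d j jd|d p q p' q' _ rp _ rq|d c p p' _ rp].
- apply: reflected_eq (reflected_add (reflected_mono (leqW jd))
    (reflected_scale (- a) (reflected_mono (jd : j.+1 <= d.+1)%N))) _ _ _ => //.
    by rewrite polyCN !exprS; ring.
  by rewrite polyCN subSS subSn // !exprS; ring.
- by rewrite !mulrDr; apply: reflected_add.
- by rewrite ![_ * (c%:P * _)]mulrCA; apply: reflected_scale.
Qed.

Lemma reflected_num_den z0 ps :
  reflected (size ps).*2.+1 (den z0 ps) (num z0 ps).
Proof.
elim: ps => [|[z w] ps IH] /=.
  have r := reflected_mul z0 (reflected_mono (leqnn 0)).
  by apply: reflected_eq r _ _ _; rewrite //= ?subnn; ring.
by apply: reflected_eq (reflected_mul z (reflected_mul w IH)) _ _ _; rewrite ?mulrA.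
Qed.

(** Everything is linear in the pair (p, p'), so the monomials of [pivot_mono_form] suffice; there
    the value (-z)^j is X^j evaluated at -z. *)
Lemma reflected_form z n p p' : reflected n.*2.+1 p p' ->
  form_value z n ((1 - z%:P * 'X) * p + (-1) ^+ n * ((z%:P + 'X) * p')) p.[- z].
Proof.
suff main d : reflected d p p' -> d = n.*2.+1 ->
    form_value z n ((1 - z%:P * 'X) * p + (-1) ^+ n * ((z%:P + 'X) * p')) p.[- z].
  by move=> r; apply: main r _.
elim=> {d p p'} [d j jd|d p q p' q' _ rp _ rq|d c p p' _ rp] dn.
- by rewrite hornerXn dn; apply: pivot_mono_form; rewrite -dn.
- apply: form_value_eq (form_value_add (rp dn) (rq dn)) _ _; first by ring.
  by rewrite hornerD.
- apply: form_value_eq (form_value_scale c (rp dn)) _ _; first by ring.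
  by rewrite hornerM hornerC.
Qed.

(* For v_i = V^i X^(n-i) the scalar is the value of v_i at (V, X) = (b, - z), the
   zero of z V + b X. *)
Lemma wedge_bidiagonal m z b (v : nat -> {poly R}) n i (x : fock m) :
  (i <= n)%N ->
  create_poly (v i) (wedge 1 [seq z%:P * v k.+1 + b%:P * v k | k <- rev (iota 0 n)] x)
  = (b ^+ i * (- z) ^+ (n - i)) *: wedge 1 [seq v k | k <- rev (iota 0 n.+1)] x.
Proof.
set r := fun k => rev (iota 0 k).
have r0 : r 0%N = [::] by [].
have rS k : r k.+1 = k :: r k by rewrite /r -addn1 iotaD rev_cat.
rewrite -[rev (iota 0 n)]/(r n) -[rev (iota 0 n.+1)]/(r n.+1).
move: r r0 rS => r r0 rS.
elim: n i => [|n IH] i.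
  by rewrite leqn0 => /eqP->; rewrite rS r0 /= subnn !expr0 mulr1 scale1r mul1r.
(* For i below the top index, v_i moves inward past the first factor and the induction hypothesis
   produces a wedge starting with v_n, which kills the term b v_n. For the top index, v_i kills its
   own copy in the first factor and only b v_n survives. *)
rewrite leq_eqVlt => /orP[/eqP->|]; last first.
  rewrite ltnS => le_in; rewrite [r n.+1]rS /= create_poly_anticomm IH // linearZ /=.
  rewrite mul1r create_polyD !create_polyZ !rS /= !mul1r create_poly_sqr scaler0 addr0.
  by rewrite -scaleNr !scalerA subSn // exprS; congr (_ *: _); ring.
rewrite [r n.+1]rS /= mul1r create_polyD !create_polyZ linearD !linearZ /=.
rewrite create_poly_sqr scaler0 add0r IH // !linearZ /= subnn expr0 mulr1.
rewrite subnn !expr0 !mulr1 exprS mulrC -!scalerA.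
by rewrite [r n.+2]rS /= mul1r.
Qed.

Definition form_bases n : seq {poly R} :=
  [seq form_basis n.-1 k | k <- rev (iota 0 n)].

Lemma wedge_form_basis m z n i g (x : fock m) : (i <= n)%N ->
  create_poly (g * form_basis n i)
    (wedge (g * ((1 - z%:P * 'X) * (z%:P + 'X))) (form_bases n) x)
  = ((1 - z ^+ 2) ^+ i * (- z) ^+ (n - i)) *: wedge g (form_bases n.+1) x.
Proof.
move=> le_in; have wg h s : wedge h s x = wedge 1 [seq h * p | p <- s] x.
  by rewrite wedge_map mul1r.
(* The factor is z V + (1 - z^2) X; multiplying by V raises the index k by one, multiplying by X
   keeps it. *)
have shift : [seq g * ((1 - z%:P * 'X) * (z%:P + 'X)) * p | p <- form_bases n]
    = [seq z%:P * (g * form_basis n k.+1) + (1 - z ^+ 2)%:P * (g * form_basis n k)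
      | k <- rev (iota 0 n)].
  rewrite -map_comp; apply/eq_in_map => k; rewrite mem_rev mem_iota add0n => /andP[_ kn].
  case: n kn {le_in} => // n kn.
  rewrite /= /form_basis /one_minus_sqrX subSS subSn // !exprS polyCB ?polyCM polyC1; ring.
rewrite wg [in RHS]wg shift -map_comp.
exact: (wedge_bidiagonal z (1 - z ^+ 2) (fun k => g * form_basis n k) x le_in).
Qed.

Lemma wedge_form_value m z n p a g (x : fock m) : form_value z n p a ->
  create_poly (g * p)
    (wedge (g * ((1 - z%:P * 'X) * (z%:P + 'X))) (form_bases n) x)
  = a *: wedge g (form_bases n.+1) x.
Proof.
elim=> [i|{}p q {}a b _ fp _ fq|c {}p {}a _ fp]; first exact: wedge_form_basis.
- by rewrite mulrDr create_polyD fp fq scalerDl.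
- by rewrite mulrCA create_polyZ fp scalerA.
Qed.

(** * The scalar in front of the fixed wedge and its closed product *)

Fixpoint product_formula z0 ps : R :=
  if ps is (z, w) :: ps' then (den z0 ps').[- z] * product_formula z0 ps'
  else 1.

(** By induction the vectors after the pivot become fixed forms of one degree less, up to a scalar;
    the pivot is a form of value [(den z0 ps).[- z]], which is the new factor. *)
Lemma wedge_numerators m z0 ps g (x : fock m) :
  wedge g (numerators z0 ps) x
  = product_formula z0 ps *: wedge g (form_bases (size ps)) x.
Proof.
elim: ps g => [|[z w] ps IH] g /=; first by rewrite scale1r.
rewrite wedge_map IH linearZ /= [RHS](_ : _ = product_formula z0 ps
  *: ((den z0 ps).[- z] *: wedge g (form_bases (size ps).+1) x)).
  congr (_ *: _).
  by apply: wedge_form_value; apply: reflected_form; apply: reflected_num_den.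
by rewrite scalerA [X in X *: _]mulrC.
Qed.

Lemma nest_vacuum m z0 ps :
  nest z0 ps (vacuum m)
  = product_formula z0 ps
    *: wedge (inv_den z0 m ps) (form_bases (size ps)) (vacuum m).
Proof. by rewrite nestE nest0_vacuum wedge_numerators. Qed.

Lemma den_horner z0 ps z :
  (den z0 ps).[- z] = (1 + z0 * z) * \prod_(p <- ps) ((1 + p.1 * z) * (1 + p.2 * z)).
Proof.
elim: ps => [|[z' w] ps IH] /=; first by rewrite big_nil !hornerE; ring.
by rewrite big_cons !hornerM IH !hornerE /=; ring.
Qed.

Lemma product_formulaE n z0 (z w : 'I_n -> R) :
  product_formula z0 [seq (z i, w i) | i <- enum 'I_n]
  = \prod_(i < n) (1 + z0 * z i)
    * \prod_(i < n) \prod_(j < n | (i < j)%N) ((1 + z i * z j) * (1 + z i * w j)).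
Proof.
elim: n z w => [|n IH] z w.
  by rewrite enum_ord0 /= !big_ord0 mulr1.
have recl (P : pred 'I_n.+1) (G : 'I_n.+1 -> R) : \prod_(j | P j) G j
    = (if P ord0 then G ord0 else 1) * \prod_(j | P (lift ord0 j)) G (lift ord0 j).
  by rewrite big_mkcond big_ord_recl -big_mkcond.
rewrite enum_ordSl /= -map_comp IH den_horner big_map big_enum /=.
rewrite [in RHS]big_ord_recl [X in _ = _ * X]big_ord_recl !recl /= !mul1r.
rewrite [X in _ = _ * (_ * X)](eq_bigr (fun i : 'I_n => \prod_(j < n | (i < j)%N)
  ((1 + z (lift ord0 i) * z (lift ord0 j)) * (1 + z (lift ord0 i) * w (lift ord0 j))))).
  rewrite [X in _ * X * _ = _](_ : _ = \prod_(j < n | (0 < bump 0 j)%N)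
    ((1 + z ord0 * z (lift ord0 j)) * (1 + z ord0 * w (lift ord0 j)))).
    by rewrite mulrACA.
  by apply: eq_big => // i _; ring.
move=> i _; rewrite recl mul1r.
by apply: eq_bigl => j; rewrite /= ltnS.
Qed.

(** * Coefficients of states and kernels of rows *)

Fixpoint coef_state m (b : seq bool) : fock m -> R :=
  if m is k.+1 then
    fun p : fock k * fock k =>
      coef_state (behead b) (if head false b then p.2 else p.1)
  else id.

Lemma coef_state_is_linear m b : linear_for *%R (@coef_state m b).
Proof.
elim: m b => [|m IH] b a x y //=; case: (head _ _); exact: IH.
Qed.
HB.instance Definition _ m b :=
  GRing.isLinear.Build R (fock m) R _ (@coef_state m b)
    (coef_state_is_linear b).

Lemma coef_state_vacuum m (b : seq bool) : size b = m ->
  coef_state b (vacuum m) = (b == nseq m false)%:R.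
Proof.
elim: m b => [|m IH] [|[] b] //= [bm]; first by rewrite raddf0.
by rewrite IH // eqseq_cons.
Qed.

(** Vectors vanishing in the first column leave it empty, so only the first vector can fill it, with
    coefficient 1. It acts last, on an empty column, so no sign appears. *)
Lemma wedge_triangular m (f : nat -> {poly R}) :
  (forall i j, (j < i)%N -> (f i)`_j = 0) -> (forall i, (f i)`_i = 1) ->
  coef_state (nseq m true) (wedge 1 [seq f i | i <- iota 0 m] (vacuum m)) = 1.
Proof.
pose wedgef k (h : nat -> nat -> R) s := foldr (fun i => create (h i)) (vacuum k) s.
have shift k (h : nat -> nat -> R) a s : (forall i, (a < i)%N -> h i 0%N = 0) ->
    all (ltn a) s ->
    wedgef k.+1 h s = (wedgef k (fun i j => h i j.+1) s, 0) :> fock k.+1.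
  move=> h0; elim: s => //= i s IH /andP[ai sa].
  by rewrite IH // /= h0 // scale0r linear0 subr0.
have wedge1 k s : wedge 1 [seq f i | i <- s] (vacuum k) = wedgef k (fun i j => (f i)`_j) s.
  elim: s => //= i s <-; rewrite mul1r //.
move=> f0 f1; rewrite wedge1.
(* The offset [a] counts the columns already peeled off. *)
suff main k a (h : nat -> nat -> R) :
    (forall i j, (j + a < i)%N -> h i j = 0) -> (forall i, h (i + a)%N i = 1) ->
    coef_state (nseq k true) (wedgef k h (iota a k)) = 1.
  by apply: main => i; rewrite ?addn0 // => j; rewrite addn0; apply: f0.
elim: k a h => //= k IH a h h0 h1.
rewrite (shift _ _ a) //=; last 2 first.
- by move=> i ai; apply: h0.
- by apply/allP => i; rewrite mem_iota => /andP[].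
rewrite linear0 subr0 -[a in h a]add0n h1 scale1r; apply: IH => i.
  by move=> j ji; apply: h0; rewrite addSnnS.
by rewrite addnS -addSn.
Qed.

(* The weight of a row turning the column state a into b. *)
Fixpoint kernel m (u w : R) (l : bool) (a b : seq bool) : R :=
  if m is k.+1 then
    let rest l' := kernel k u w l' (behead a) (behead b) in
    match l, head false a, head false b with
    | false, false, false => rest false
    | false, true, false => (1 + u * w) * rest true
    | false, true, true => w * rest false
    | false, false, true => 0
    | true, false, false => u * rest true
    | true, false, true => rest false
    | true, true, true => rest true
    | true, true, false => 0
    end
  else (~~ l)%:R.

Lemma big_tuple_cons (T : finType) n (f : n.+1.-tuple T -> R) :
  \sum_t f t = \sum_x \sum_(t : n.-tuple T) f [tuple of x :: t].
Proof.
rewrite pair_big /= (reindex (fun p : T * n.-tuple T => [tuple of p.1 :: p.2])) //=.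
exists (fun t => (thead t, [tuple of behead t])) => [[x t] _ /=|t _].
  by congr pair; apply: val_inj.
by rewrite [RHS]tuple_eta.
Qed.

Lemma coef_transfer m u w l (b : m.-tuple bool) (x : fock m) :
  coef_state b (transfer u w l x)
  = \sum_(a : m.-tuple bool) kernel m u w l a b * coef_state a x.
Proof.
elim: m l b x => [|m IH] l b x.
  rewrite (big_pred1 [tuple]) => [|a]; last by apply/esym/eqP; rewrite [a]tuple0.
  by case: l => /=; rewrite ?mul0r ?mul1r.
case/tupleP: b => b t; rewrite big_tuple_cons big_bool /=.
case: l; case: b => /=; rewrite ?linearD ?linearZ /= !IH ?mulr_sumr -?big_split /=;
  rewrite -?big_split /=; apply: eq_bigr => a _ /=; ring.
Qed.

(** [P] and [Q] are the column states above and below the whole nest; [X] holds the two states just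
    inside its outermost pair of rows. *)
Fixpoint nest_kernel m z0 (ps : seq (R * R)) (P Q : m.-tuple bool) : R :=
  if ps is (z, w) :: ps' then
    \sum_(X : m.-tuple bool * m.-tuple bool)
      (kernel m z w false P X.1 * kernel m w z true X.2 Q
       + kernel m z w true P X.1 * kernel m w z false X.2 Q)
      * nest_kernel z0 ps' X.1 X.2
  else kernel m z0 z0 false P Q.

Lemma coef_nest m z0 ps (Q : m.-tuple bool) (x : fock m) :
  coef_state Q (nest z0 ps x)
  = \sum_(P : m.-tuple bool) nest_kernel z0 ps P Q * coef_state P x.
Proof.
elim: ps Q x => [|[z w] ps IH] Q x /=; first exact: coef_transfer.
have half l l' : coef_state Q (transfer w z l (nest z0 ps (transfer z w l' x)))
  = \sum_(P : m.-tuple bool) (\sum_(X : m.-tuple bool * m.-tuple bool)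
     kernel m z w l' P X.1 * kernel m w z l X.2 Q * nest_kernel z0 ps X.1 X.2)
     * coef_state P x.
  rewrite coef_transfer.
  under eq_bigr => Q' _.
    rewrite IH mulr_sumr.
    under eq_bigr => P' _.
      rewrite coef_transfer !mulr_sumr.
      over.
    over.
  rewrite pair_big_dep exchange_big /=; apply: eq_bigr => P _.
  rewrite mulr_suml [RHS](reindex (fun X => (X.2, X.1))) /=; last first.
    by exists (fun X => (X.2, X.1)) => [[]|[]].
  by apply: eq_bigr => X _; ring.
rewrite linearD /= !half -big_split /=; apply: eq_bigr => P _.
by rewrite -mulrDl -big_split /=; congr (_ * _); apply: eq_bigr => X _; rewrite -mulrDl.
Qed.

Lemma coef_nest_vacuum m z0 ps (Q : m.-tuple bool) :
  coef_state Q (nest z0 ps (vacuum m))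
  = nest_kernel z0 ps [tuple of nseq m false] Q.
Proof.
rewrite coef_nest (bigD1 [tuple of nseq m false]) //=.
rewrite coef_state_vacuum ?size_nseq // eqxx mulr1 big1 ?addr0 // => P.
by rewrite -val_eqE /= coef_state_vacuum ?size_tuple // => /negPf->; rewrite mulr0.
Qed.

Lemma kernel_count m u w l (a b : m.-tuple bool) :
  kernel m u w l a b != 0 -> count id b = (l + count id a)%N.
Proof.
elim: m l a b => [|m IH] l a b.
  by rewrite [a]tuple0 [b]tuple0; case: l => //=; rewrite eqxx.
case/tupleP: a => a s; case/tupleP: b => b t.
have nz c v : c * v != 0 :> R -> v != 0 by apply: contraNneq => ->; rewrite mulr0.
by case: l; case: a; case: b => /=; rewrite ?eqxx // => H;
  do ?[move/nz: H => H]; move/IH: H => ->; lia.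
Qed.

(** Each pair of rows fills one more column and the central row none. This is what makes the powers
    of [y] cancel later. *)
Lemma nest_kernel_count m z0 ps (P Q : m.-tuple bool) :
  nest_kernel z0 ps P Q != 0 -> count id Q = (size ps + count id P)%N.
Proof.
elim: ps P Q => [|[z w] ps IH] P Q /=; first by move/kernel_count.
apply: contraNeq => neq; apply/eqP; rewrite big1 // => X _.
have [->|nz] := eqVneq (nest_kernel z0 ps X.1 X.2) 0; first by rewrite mulr0.
(* The row sums [l] and [~~ l] add up to 1, so a nonzero product would give the excluded count. *)
have H l : kernel m z w l P X.1 * kernel m w z (~~ l) X.2 Q = 0.
  have [->|/kernel_count k1] := eqVneq (kernel m z w l P X.1) 0; first by rewrite mul0r.
  have [->|/kernel_count k2] := eqVneq (kernel m w z (~~ l) X.2 Q) 0; first by rewrite mulr0.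
  case/eqP: neq; rewrite k2 (IH _ _ nz) k1; case: (l) => /=; lia.
by rewrite (H false) (H true) addr0 mul0r.
Qed.

(** * Sums over paths of states *)

Fixpoint chain n (X : finType) : ('I_n -> X -> X -> R) -> (X -> R) -> X -> R :=
  if n is k.+1 then fun K g x =>
    \sum_y K ord0 x y * chain (fun i : 'I_k => K (lift ord0 i)) g y
  else fun _ g x => g x.

Lemma chainE n (X : finType) (K : 'I_n -> X -> X -> R) g x :
  \sum_(t : n.-tuple X)
     (\prod_(i < n) K i (nth x (x :: t) i) (nth x (x :: t) i.+1)) * g (last x t)
  = chain K g x.
Proof.
elim: n K x => [|n IH] K x.
  by rewrite (big_pred1 [tuple]) ?big_ord0 ?mul1r // => t; apply/esym/eqP; rewrite [t]tuple0.
rewrite big_tuple_cons /=; apply: eq_bigr => y _; rewrite -IH mulr_sumr.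
apply: eq_bigr => t _; rewrite big_ord_recl /= mulrA; congr (_ * _ * _).
apply: eq_bigr => i _; congr (K _ _ _).
  by apply: set_nth_default; rewrite /= size_tuple ltnS ltnW ?ltn_ord.
by apply: set_nth_default; rewrite /= size_tuple ltn_ord.
Qed.

Lemma eq_chain n (X : finType) (K K' : 'I_n -> X -> X -> R) g :
  (forall i x y, K i x y = K' i x y) -> chain K g =1 chain K' g.
Proof.
elim: n K K' => [//|n IH] K K' KK x /=; apply: eq_bigr => y _.
by rewrite KK (IH _ (fun i => K' (lift ord0 i))) // => i; apply: KK.
Qed.

(** * Rows as pairs of consecutive column states *)

Definition entry (a b : seq bool) (k : nat) : int :=
  (nth false b k)%:R - (nth false a k)%:R.

Definition row_sum m (a b : seq bool) : int := \sum_(k < m) entry a b k.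

Definition row_valid m (a b : seq bool) : bool :=
  [forall j : 'I_m, zero_or_one (\sum_(k < m | (j <= k)%N) entry a b k)].

(** The case split of [compass], where [a] and [b] are the column states above and below the
    vertex. *)
Definition vertex (a b : bool) (east : int) : compass_point :=
  if b%:R - a%:R == 1 :> int then WE else if b%:R - a%:R == -1 :> int then NS
  else if a%:R == 0 :> int then (if east == 0 then SE else SW)
  else (if east == 0 then NE else NW).

Definition row_vertex m (a b : seq bool) (j : 'I_m) : compass_point :=
  vertex (nth false a j) (nth false b j) (\sum_(k < m | (j < k)%N) entry a b k).

Definition vertex_wgt (u w : R) (c : compass_point) : R :=
  match c with
  | WE => 1 | NS => 1 + u * w | NE => w | SE => 1 | NW => 1 | SW => u
  end.

Lemma entryS a b k : entry (behead a) (behead b) k = entry a b k.+1.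
Proof. by rewrite /entry !nth_behead. Qed.

Lemma row_sumS m a b :
  row_sum m.+1 a b = entry a b 0 + row_sum m (behead a) (behead b).
Proof.
rewrite /row_sum big_ord_recl; congr (_ + _).
by apply: eq_bigr => k _; rewrite entryS.
Qed.

Lemma row_validS m a b :
  row_valid m.+1 a b
  = zero_or_one (row_sum m.+1 a b) && row_valid m (behead a) (behead b).
Proof.
have tl (j : 'I_m) : \sum_(k < m.+1 | (j.+1 <= k)%N) entry a b k
    = \sum_(k < m | (j <= k)%N) entry (behead a) (behead b) k.
  rewrite [LHS]big_mkcond big_ord_recl [RHS]big_mkcond /= add0r.
  by apply: eq_bigr => k _; rewrite entryS.
apply/forallP/andP => [v|[v0 /forallP v] j].
  split; first exact: (v ord0).
  by apply/forallP => j; rewrite -tl; apply: (v (lift ord0 j)).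
by case: (unliftP ord0 j) => [j' ->|->]; rewrite ?tl.
Qed.

Lemma row_valid_sum m a b : row_valid m a b -> zero_or_one (row_sum m a b).
Proof.
case: m => [|m]; first by rewrite /row_sum big_ord0.
by rewrite row_validS => /andP[].
Qed.

Lemma row_vertexS m a b (j : 'I_m) :
  row_vertex a b (lift ord0 j) = row_vertex (behead a) (behead b) j.
Proof.
rewrite /row_vertex !nth_behead; congr vertex.
rewrite [LHS]big_mkcond big_ord_recl [RHS]big_mkcond /= add0r.
by apply: eq_bigr => k _; rewrite entryS.
Qed.

Lemma row_vertex0 m a b :
  row_vertex a b (@ord0 m)
  = vertex (head false a) (head false b) (row_sum m (behead a) (behead b)).
Proof.
rewrite /row_vertex !nth0; congr vertex.
rewrite [LHS]big_mkcond big_ord_recl /= add0r.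
by apply: eq_bigr => k _; rewrite entryS.
Qed.

(** The entries beyond the first column sum to the state of the edge joining it to them. Validity
    makes this sum 0 or 1, and the branches of [kernel] are the ways it can balance the first entry
    and [l]. *)
Lemma kernelE m u w l a b :
  kernel m u w l a b
  = if row_valid m a b && (row_sum m a b == l%:R) then
      \prod_(j < m) vertex_wgt u w (row_vertex a b j)
    else 0.
Proof.
elim: m l a b => [|m IH] l a b /=.
  rewrite /row_sum !big_ord0 (_ : row_valid 0 a b); last by apply/forallP => -[].
  by case: l.
rewrite !IH row_validS row_sumS big_ord_recl row_vertex0 {1 2}/entry !nth0.
under [in RHS]eq_bigr => j _ do rewrite row_vertexS.
set P := \prod_(j < m) _; have := @row_valid_sum m (behead a) (behead b).
case: row_valid => /= [|_]; last first.
  by rewrite andbF; case: l (head _ a) (head _ b) => [] [] []; rewrite ?mulr0.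
move=> /(_ isT)/orP[]/eqP->;
  case: l (head _ a) (head _ b) => [] [] [] /=; by rewrite ?mulr0 ?mul1r.
Qed.

End Fock.

(** * HTSASMs as chains of column states *)

Section Correspondence.
Variables (n m : nat) (lam : n.-tuple nat).
Local Notation N := (n + 1 + n)%N.
Local Notation state := (m.-tuple bool).

Definition part_state : state := [tuple j.+1 \in lam | j < m].

Definition boundary : state * state := ([tuple of nseq m false], part_state).

(* The pairs of t are the column states after row i and before row N + 1 - i. *)
Definition row_state (t : n.-tuple (state * state)) (k : nat) : state :=
  if (k <= n)%N then (nth boundary (boundary :: t) k).1
  else (nth boundary (boundary :: t) (N - k)).2.

Lemma sign_mem (a b : bool) : b%:R - a%:R \in [:: 0; 1; -1 : int].
Proof. by case: a; case: b. Qed.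

Definition matrix_of (t : n.-tuple (state * state)) : 'M[sign_entry]_(N, m) :=
  \matrix_(i, j) SeqSub (sign_mem (nth false (row_state t i) j)
                                  (nth false (row_state t i.+1) j)).

Definition col_sum (A : 'M[int]_(N, m)) (k : nat) (j : 'I_m) : int :=
  \sum_(i < N | (i < k)%N) A i j.

Definition col_state A (k : nat) : state := [tuple col_sum A k j == 1 | j < m].

Definition states_of (A : 'M[sign_entry]_(N, m)) : n.-tuple (state * state) :=
  [tuple (col_state (map_mx val A) i.+1, col_state (map_mx val A) (N - i.+1)) | i < n].

Lemma col_sum0 A j : col_sum A 0 j = 0.
Proof. by rewrite /col_sum big_pred0. Qed.

Lemma col_sumS A (i : 'I_N) j : col_sum A i.+1 j = col_sum A i j + A i j.
Proof.
rewrite /col_sum (bigD1 i) //= addrC; congr (_ + _).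
by apply: eq_bigl => k; rewrite ltnS ltn_neqAle andbC.
Qed.

Lemma row_state0 t : row_state t 0 = [tuple of nseq m false].
Proof. by []. Qed.

Lemma row_stateN t : row_state t N = part_state.
Proof. by rewrite /row_state leqNgt (_ : (n < N)%N) ?subnn //=; lia. Qed.

Lemma row_state_upper t k : (k <= n)%N ->
  row_state t k = (nth boundary (boundary :: t) k).1.
Proof. by rewrite /row_state => ->. Qed.

Lemma row_state_lower t k : (k <= n)%N ->
  row_state t (N - k) = (nth boundary (boundary :: t) k).2.
Proof.
move=> kn; rewrite /row_state leqNgt (_ : (n < N - k)%N) /=; last lia.
by congr ((nth _ _ _).2); lia.
Qed.

Lemma matrix_ofE t i j :
  map_mx val (matrix_of t) i j = entry (row_state t i) (row_state t i.+1) j.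
Proof. by rewrite !mxE. Qed.

Lemma col_sum_matrix_of t k j : (k <= N)%N ->
  col_sum (map_mx val (matrix_of t)) k j = (nth false (row_state t k) j)%:R.
Proof.
elim: k => [|k IH] kN; first by rewrite col_sum0 row_state0 nth_nseq if_same.
rewrite (col_sumS _ (Ordinal kN)) IH ?(ltnW kN) // matrix_ofE /entry /=.
by rewrite addrC subrK.
Qed.

Lemma nth_col_state A k (j : 'I_m) :
  nth false (col_state A k) j = (col_sum A k j == 1).
Proof. by rewrite -tnth_nth tnth_mktuple. Qed.

Lemma matrix_ofK : cancel matrix_of states_of.
Proof.
move=> t; have stateE k : (k <= N)%N ->
    col_state (map_mx val (matrix_of t)) k = row_state t k.
  move=> kN; apply: eq_from_tnth => j.
  rewrite !(tnth_nth false) nth_col_state col_sum_matrix_of //.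
  by case: nth.
apply: eq_from_tnth => i; rewrite tnth_mktuple !stateE ?leq_subr //; last first.
  by have := ltn_ord i; lia.
rewrite row_state_upper // row_state_lower //= (tnth_nth boundary).
by case: nth.
Qed.

Lemma nth_states_of A k : (k < n)%N ->
  nth boundary (boundary :: states_of A) k.+1
  = (col_state (map_mx val A) k.+1, col_state (map_mx val A) (N - k.+1)).
Proof.
move=> kn; rewrite -[LHS]/(nth boundary (states_of A) (Ordinal kn)) -tnth_nth.
by rewrite tnth_mktuple.
Qed.

(** The column conditions make all partial column sums 0 or 1 and fix the last state; entries are
    differences of consecutive partial sums. *)
Lemma states_ofK A : is_htsasm lam (map_mx val A) -> matrix_of (states_of A) = A.
Proof.
set B := map_mx val A => /and5P[_ _ /forallP B01 _ /forallP BN].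
have sum01 k j : (k <= N)%N -> col_sum B k j = (nth false (col_state B k) j)%:R.
  rewrite nth_col_state; case: k => [|k] kN; first by rewrite col_sum0.
  by rewrite /col_sum; have /forallP/(_ j) := B01 (Ordinal kN) => /orP[]/eqP ->.
have stateE k : (k <= N)%N -> row_state (states_of A) k = col_state B k.
  move=> kN; have [kn|kn] := leqP k n.
    rewrite row_state_upper //; case: k kN kn => [|k] kN kn.
      apply: eq_from_tnth => j; rewrite !(tnth_nth false) nth_col_state col_sum0.
      by rewrite nth_nseq if_same.
    by rewrite nth_states_of.
  have kE : k = (N - (N - k))%N by lia.
  rewrite {1}kE row_state_lower; last lia.
  (* Position 0 is the boundary pair: below the last row the total column sums determine the
     state. *)
  case E : (N - k)%N => [|k'].
    have -> : k = N by lia.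
    apply: eq_from_tnth => j; rewrite !(tnth_nth false) nth_col_state.
    rewrite -tnth_nth tnth_mktuple; have /eqP := BN j; rewrite /col_sum.
    rewrite (eq_bigl (fun i : 'I_N => (i < N)%N)) => [->|i]; last by rewrite ltn_ord.
    by case: (_ \in _).
  have k'n : (k' < n)%N by lia.
  by rewrite nth_states_of //; congr col_state; lia.
apply/matrixP => i j; apply: val_inj.
have -> : val (matrix_of (states_of A) i j) = map_mx val (matrix_of (states_of A)) i j.
  by rewrite [RHS]mxE.
have -> : val (A i j) = B i j by rewrite [RHS]mxE.
rewrite matrix_ofE /entry !stateE ?(ltnW (ltn_ord i)) // -!sum01 ?(ltnW (ltn_ord i)) //.
by rewrite col_sumS addrC addKr.
Qed.

Lemma compass_matrix_of t i j :
  compass (map_mx val (matrix_of t)) i j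
  = row_vertex (row_state t i) (row_state t i.+1) j.
Proof.
rewrite /compass -/(col_sum _ i j) col_sum_matrix_of ?(ltnW (ltn_ord i)) //.
rewrite matrix_ofE; under eq_bigr => k _ do rewrite matrix_ofE.
by [].
Qed.

(** The column conditions hold for every matrix built from states. The U-turn condition (ii) follows
    from (i) and (iv), since a prefix sum of the reflected row is its total minus a suffix sum. *)
Lemma is_htsasm_matrix_of t (S := row_state t) :
  is_htsasm lam (map_mx val (matrix_of t))
  = [forall i : 'I_n,
      [&& row_valid m (S i) (S i.+1),
          row_valid m (S (N - i.+1)%N) (S (N - i.+1).+1) &
          row_sum m (S i) (S i.+1)
          + row_sum m (S (N - i.+1)%N) (S (N - i.+1).+1) == 1]]
    && (row_valid m (S n) (S n.+1) && (row_sum m (S n) (S n.+1) == 0)).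
Proof.
set B := map_mx val _; set e := fun k => row_sum m (S k) (S k.+1).
set v := fun k => row_valid m (S k) (S k.+1).
have BE i (P : pred 'I_m) : \sum_(k | P k) B i k = \sum_(k | P k) entry (S i) (S i.+1) k.
  by apply: eq_bigr => k _; rewrite matrix_ofE.
have eE i : \sum_k B i k = e i by rewrite BE.
have c4 i : \sum_j (B i j + B (rev_ord i) j) + eps i
    = e i + e (N - i.+1)%N + (i == n :> nat)%:R.
  by rewrite big_split /= !eE.
apply/and5P/andP => [[/forallP c1 _ _ /forallP cc4 _]|[/forallP c1 /andP[vn /eqP en]]].
  have vk k : (k < N)%N -> v k.
    move=> kN; have /forallP c := c1 (Ordinal kN).
    by apply/forallP => j; have := c j; rewrite BE.
  have ek k : (k < N)%N -> e k + e (N - k.+1)%N + (k == n)%:R = 1.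
    by move=> kN; have /eqP := cc4 (Ordinal kN); rewrite c4.
  have nN : (n < N)%N by lia.
  split.
    apply/forallP => i; have iN : (i < N)%N by have := ltn_ord i; lia.
    apply/and3P; split; first exact: vk.
      by apply: vk; have := ltn_ord i; lia.
    by have /= := ek _ iN; rewrite ltn_eqF // addr0 => ->.
  apply/andP; split; first exact: vk.
  (* The central row is its own partner: twice its sum plus 1 equals 1. *)
  have := ek _ nN.
  by rewrite eqxx (_ : N - n.+1 = n)%N /e; lia.
have vk k : (k < N)%N -> v k.
  move=> kN; have [kn|kn|->//] := ltngtP k n.
    by have /and3P[] := c1 (Ordinal kn).
  have k'n : (N - k.+1 < n)%N by lia.
  have /and3P[_ + _] := c1 (Ordinal k'n).
  by rewrite /= (_ : N - (N - k.+1).+1 = k)%N //; lia.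
have ek k : (k < N)%N -> e k + e (N - k.+1)%N + (k == n)%:R = 1.
  move=> kN; have [kn|kn|->] := ltngtP k n.
  - by have /and3P[_ _ /eqP <-] := c1 (Ordinal kn); rewrite addr0.
  - have k'n : (N - k.+1 < n)%N by lia.
    have /and3P[_ _ /eqP <-] := c1 (Ordinal k'n).
    by rewrite /= addr0 addrC (_ : N - (N - k.+1).+1 = k)%N //; lia.
  - by rewrite (_ : N - n.+1 = n)%N ?/e ?en; lia.
split; apply/forallP => i; try apply/forallP => j.
- by rewrite BE; have /forallP/(_ j) := vk i (ltn_ord i).
- have iN := ltn_ord (rev_ord i); have /forallP vi := vk _ iN.
  have := ek i (ltn_ord i); rewrite eE BE /eps.
  have : e (rev_ord i) = \sum_(k < m | (k < j)%N) entry (S (rev_ord i)) (S (rev_ord i).+1) k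
     + \sum_(k < m | (j <= k)%N) entry (S (rev_ord i)) (S (rev_ord i).+1) k.
    rewrite /e /row_sum (bigID (fun k : 'I_m => (k < j)%N)) /=; congr (_ + _).
    by apply: eq_bigl => k; rewrite -leqNgt.
  have : zero_or_one (\sum_(k < m | (j <= k)%N) entry (S (rev_ord i)) (S (rev_ord i).+1) k).
    (* For j = m the suffix is empty. *)
    have [jm|jm] := ltnP j m; first exact: (vi (Ordinal jm)).
    by rewrite big_pred0 // => k; apply/negbTE; rewrite -ltnNge (leq_trans (ltn_ord k)).
  rewrite /zero_or_one /=; lia.
- have := @col_sum_matrix_of t i.+1 j (ltn_ord i).
  rewrite /col_sum (eq_bigl (fun k : 'I_N => (k <= i)%N)) // => ->.
  by case: nth.
- by rewrite c4 ek.
- rewrite (_ : \sum_i0 _ = col_sum B N i); last first.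
    by apply: eq_bigl => k; rewrite ltn_ord.
  by rewrite col_sum_matrix_of // row_stateN -tnth_nth tnth_mktuple.
Qed.

End Correspondence.

(** * Weights of HTSASMs as weights of paths *)

Lemma prod_if (R : comNzRingType) (I : finType) (c : pred I) (f : I -> R) :
  \prod_i (if c i then f i else 0) = if [forall i, c i] then \prod_i f i else 0.
Proof.
case: ifPn => [/forallP call|]; first by apply: eq_bigr => i _; rewrite call.
by rewrite negb_forall => /existsP[i /negPf ci]; rewrite (bigD1 i) //= ci mul0r.
Qed.

Lemma kernel_pair (R : comNzRingType) m (z w : R) a b c d :
  kernel m z w false a b * kernel m w z true c d
  + kernel m z w true a b * kernel m w z false c d
  = if [&& row_valid m a b, row_valid m c d & row_sum m a b + row_sum m c d == 1]
    then (\prod_(j < m) vertex_wgt z w (row_vertex a b j))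
         * \prod_(j < m) vertex_wgt w z (row_vertex c d j)
    else 0.
Proof.
rewrite !kernelE; have := @row_valid_sum m a b; have := @row_valid_sum m c d.
case: (row_valid m a b); case: (row_valid m c d);
  rewrite ?(mul0r, mulr0, addr0) // => /(_ isT)/orP[]/eqP-> /(_ isT)/orP[]/eqP->;
  by rewrite /= ?(mul0r, mulr0, addr0, add0r).
Qed.

Lemma prod_exp_count (R : comNzRingType) (y : R) (p : pred bool) m (b : m.-tuple bool) :
  \prod_(j < m) y ^+ p (nth false b j) = y ^+ count p b.
Proof.
rewrite prodrXr; congr (_ ^+ _); rewrite -sum1_count big_tuple [RHS]big_mkcond.
by apply: eq_bigr => j _; rewrite (tnth_nth false); case: (p _).
Qed.

Section Weights.
Variables (F : fieldType) (n m : nat) (lam : n.-tuple nat).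
Variables (x y s t : 'I_n -> F) (z0 : F).
Hypothesis y_neq0 : forall i, y i != 0.
Local Notation N := (n + 1 + n)%N.
Local Notation state := (m.-tuple bool).
Local Notation z i := (s i * x i).
Local Notation w i := (t i * (y i)^-1).

(** With t_k = y_k w_k, an upper vertex carries a factor y_k exactly when the column below it is
    occupied. *)
Lemma prod_upper_wgt k (a b : state) :
  \prod_(j < m) upper_wgt x y s t k (row_vertex a b j)
  = y k ^+ count id b * \prod_(j < m) vertex_wgt (z k) (w k) (row_vertex a b j).
Proof.
rewrite -prod_exp_count -big_split /=; apply: eq_bigr => j _.
rewrite /row_vertex /vertex; set e := bigop _ _ _; case: (nth false a j); case: (nth false b j);
  case: (e == 0) => /=; rewrite ?expr1 ?expr0 ?mul1r ?mulr1 //.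
all: by [rewrite mulrA | rewrite mulrCA divff ?mulr1].
Qed.

(** A lower vertex carries a factor y_k exactly when the column above it is empty. *)
Lemma prod_lower_wgt k (a b : state) :
  \prod_(j < m) lower_wgt x y s t k (row_vertex a b j)
  = y k ^+ count negb a * \prod_(j < m) vertex_wgt (w k) (z k) (row_vertex a b j).
Proof.
rewrite -prod_exp_count -big_split /=; apply: eq_bigr => j _.
rewrite /row_vertex /vertex; set e := bigop _ _ _; case: (nth false a j); case: (nth false b j);
  case: (e == 0) => /=; rewrite ?expr1 ?expr0 ?mul1r ?mulr1 //.
all: by [rewrite [in RHS]mulrC mulrA | rewrite mulrCA divff ?mulr1].
Qed.

(** [X] holds the states outside the i-th pair of rows and [Y] those inside; all powers of y_i are
    read off [Y]. *)
Definition step (i : 'I_n) (X Y : state * state) : F :=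
  y i ^ (n%:Z - m%:Z - (i.+1)%:Z) * (y i ^+ count id Y.1 * y i ^+ count negb Y.2)
  * (kernel m (z i) (w i) false X.1 Y.1 * kernel m (w i) (z i) true Y.2 X.2
     + kernel m (z i) (w i) true X.1 Y.1 * kernel m (w i) (z i) false Y.2 X.2).

Lemma wgt_matrix_of (T : n.-tuple (state * state)) (S := row_state lam T) :
  wgt x y s t z0 (map_mx val (matrix_of lam T))
  = (\prod_(i < n) y i ^ (n%:Z - m%:Z - (i.+1)%:Z))
    * (\prod_(i < n)
         ((\prod_(j < m) upper_wgt x y s t i (row_vertex (S i) (S i.+1) j))
          * \prod_(j < m) lower_wgt x y s t i
              (row_vertex (S (N - i.+1)%N) (S (N - i.+1).+1) j))
       * \prod_(j < m) central_wgt z0 (row_vertex (S n) (S n.+1) j)).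
Proof.
rewrite /wgt; congr (_ * _).
under eq_bigr => i _ do under eq_bigr => j _ do rewrite compass_matrix_of.
rewrite [LHS]big_split_ord [X in X * _ = _]big_split_ord big_ord1 /= [LHS]mulrAC.
rewrite [X in _ = X * _]big_split /=; congr (_ * _ * _).
- apply: eq_bigr => i _; apply: eq_bigr => j _.
  by rewrite /row_wgt (unsplitK (inl _)) (unsplitK (inl _)).
(* Lower rows are listed from the bottom up, so that each meets its upper partner. *)
- rewrite (reindex_inj rev_ord_inj) /=; apply: eq_bigr => i _; apply: eq_bigr => j _.
  rewrite /row_wgt (unsplitK (inr _)) rev_ordK /=.
  by congr (lower_wgt _ _ _ _ _ (row_vertex (S _) (S _) _)); have := ltn_ord i; lia.
- apply: eq_bigr => j _; rewrite /row_wgt (unsplitK (inl _)) (unsplitK (inr _)).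
  by rewrite /= addn0.
Qed.

Lemma step_prod (T : n.-tuple (state * state)) :
  (if is_htsasm lam (map_mx val (matrix_of lam T))
   then wgt x y s t z0 (map_mx val (matrix_of lam T)) else 0)
  = (\prod_(i < n) step i (nth (boundary m lam) (boundary m lam :: T) i)
                          (nth (boundary m lam) (boundary m lam :: T) i.+1))
    * kernel m z0 z0 false (last (boundary m lam) T).1 (last (boundary m lam) T).2.
Proof.
set S := row_state lam T.
have Nn (i : 'I_n) : (N - i.+1).+1 = (N - i)%N by have := ltn_ord i; lia.
rewrite (eq_bigr (fun i : 'I_n => if [&& row_valid m (S i) (S i.+1),
    row_valid m (S (N - i.+1)%N) (S (N - i.+1).+1) &
    row_sum m (S i) (S i.+1) + row_sum m (S (N - i.+1)%N) (S (N - i.+1).+1) == 1]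
  then y i ^ (n%:Z - m%:Z - (i.+1)%:Z)
    * ((\prod_(j < m) upper_wgt x y s t i (row_vertex (S i) (S i.+1) j))
          * \prod_(j < m) lower_wgt x y s t i
              (row_vertex (S (N - i.+1)%N) (S (N - i.+1).+1) j)) else 0)); last first.
  move=> i _; rewrite /step kernel_pair Nn /S.
  rewrite !row_state_lower ?(ltnW (ltn_ord i)) // !row_state_upper ?(ltnW (ltn_ord i)) //.
  case: ifP => _; last by rewrite mulr0.
  by rewrite prod_upper_wgt prod_lower_wgt; ring.
have -> : last (boundary m lam) T = (S n, S n.+1).
  rewrite -[last _ _]/(last (boundary m lam) (boundary m lam :: T)) -nth_last /= size_tuple.
  rewrite /S row_state_upper // (_ : n.+1 = N - n)%N; last lia.
  by rewrite row_state_lower // -surjective_pairing.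
rewrite prod_if kernelE is_htsasm_matrix_of -/S wgt_matrix_of -/S.
case: [forall i, _] => /=; last by rewrite mul0r.
case: ifP => _; last by rewrite mulr0.
by rewrite [LHS]mulrA [X in _ = X * _]big_split.
Qed.

Lemma sum_htsasm_weights :
  \sum_(A : 'M[sign_entry]_(N, m) | is_htsasm lam (map_mx val A))
    wgt x y s t z0 (map_mx val A)
  = chain step (fun X => kernel m z0 z0 false X.1 X.2) (boundary m lam).
Proof.
rewrite (reindex_onto (matrix_of lam) (@states_of n m)) => [|A]; last exact: states_ofK.
rewrite -chainE [LHS]big_mkcond; apply: eq_bigr => T _.
by rewrite matrix_ofK eqxx andbT step_prod.
Qed.

End Weights.

(** The rows inside the outermost of n+1 pairs fill n columns: if [Y.1] occupies c of them, [Y.2]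
    occupies n + c, and the exponent (n + 1 - m - 1) + c + (m - n - c) of the outermost parameter is
    0. *)
Lemma chain_step (F : fieldType) n m (x y s t : 'I_n -> F) z0
    (X : m.-tuple bool * m.-tuple bool) :
  (forall i, y i != 0) ->
  chain (step x y s t) (fun X => kernel m z0 z0 false X.1 X.2) X
  = nest_kernel z0 [seq (s i * x i, t i * (y i)^-1) | i <- enum 'I_n] X.1 X.2.
Proof.
elim: n x y s t X => [|n IH] x y s t X y_neq0 /=; first by rewrite enum_ord0.
rewrite enum_ordSl /= -map_comp; apply: eq_bigr => Y _.
set ps := map _ _; set K := fun i : 'I_n => step x y s t (lift ord0 i).
have -> : chain K (fun X => kernel m z0 z0 false X.1 X.2) Y
    = nest_kernel z0 ps Y.1 Y.2.
  rewrite -(IH (x \o lift ord0) (y \o lift ord0) (s \o lift ord0) (t \o lift ord0)) /=.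
    apply: eq_chain => i Z Z'.
    (* Removing the outermost pair lowers both n and the row index by one, so n - m - i is
       unchanged. *)
    by rewrite /K /step lift0; congr (_ ^ _ * _ * _); lia.
  by move=> i; apply: y_neq0.
(* The occupation counts are known only when the inner kernel is nonzero; otherwise both sides
   vanish. *)
have [->|nz] := eqVneq (nest_kernel z0 ps Y.1 Y.2) 0; first by rewrite !mulr0.
congr (_ * _); rewrite /step.
suff -> : y ord0 ^ (n.+1%:Z - m%:Z - 1%:Z)
   * (y ord0 ^+ count id Y.1 * y ord0 ^+ count negb Y.2) = 1 by rewrite mul1r.
have := nest_kernel_count nz; rewrite size_map size_enum_ord => c2.
have := count_predC id Y.2; rewrite size_tuple => c3.
rewrite -exprD exprnP -expfzDr ?y_neq0 //.
rewrite (_ : _ + _ = 0) ?expr0z //; rewrite -[count negb _]/(count (predC id) _); lia.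
Qed.

(** * The partition function and its symmetric factor *)

Lemma htsasm_sumE (F : fieldType) n (lam : n.-tuple nat) (x y s t : 'I_n -> F) z0
    (m := head 0%N lam) :
  (forall i, y i != 0) ->
  htsasm_sum x y s t z0 lam
  = product_formula z0 [seq (s i * x i, t i * (y i)^-1) | i <- enum 'I_n]
    * coef_state (part_state m lam)
        (wedge (\prod_i geom m (zvec x y s t z0 0 i)) (form_bases F n) (vacuum F m)).
Proof.
move=> y_neq0; rewrite /htsasm_sum; set ps := map _ _.
rewrite (eq_bigl (fun A => is_htsasm lam (map_mx val A))) => [|A]; last by rewrite inE.
rewrite sum_htsasm_weights // chain_step //= -coef_nest_vacuum nest_vacuum linearZ /=.
rewrite size_map size_enum_ord; congr (_ * coef_state _ (wedge _ _ _)).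
have -> l : inv_den z0 m l
    = (\prod_(p <- l) geom m p.1) * geom m z0 * \prod_(p <- l) geom m p.2.
  elim: l => [|[z w] l IH] /=; first by rewrite !big_nil mul1r mulr1.
  by rewrite !big_cons IH /=; ring.
rewrite !(big_map (fun i => (s i * x i, t i * (y i)^-1))) !big_enum big_split_ord.
rewrite [X in _ = X * _]big_split_ord big_ord1 /=.
congr (_ * _ * _); last first.
- by apply: eq_bigr => i _; rewrite row_mxEr mxE.
- by rewrite row_mxEl row_mxEr mxE.
- by apply: eq_bigr => i _; rewrite !row_mxEl mxE.
Qed.

Lemma wedge_staircase (R : comNzRingType) n m (g : {poly R}) : m = n ->
  g`_0 = 1 ->
  coef_state (part_state m (staircase n)) (wedge g (form_bases R n) (vacuum R m)) = 1.
Proof.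
move=> -> g0.
have -> : part_state n (staircase n) = nseq n true :> seq bool.
  apply: (@eq_from_nth _ false) => [|i]; rewrite size_tuple ?size_nseq // => lt_in.
  rewrite -[i]/(nat_of_ord (Ordinal lt_in)) nth_nseq lt_in -tnth_nth tnth_mktuple.
  apply/tnthP; exists (rev_ord (Ordinal lt_in)); rewrite tnth_mktuple /=; lia.
pose f i : {poly R} := g * (one_plus_sqrX R * one_minus_sqrX R ^+ (n.-1 - i) * 'X^i).
have -> : wedge g (form_bases R n) (vacuum R n)
    = wedge 1 [seq f i | i <- iota 0 n] (vacuum R n).
  rewrite -[in LHS](mul1r g) -wedge_map /form_bases; congr wedge.
  (* In this order the i-th form carries the power X^i, which makes the family unitriangular. *)
  have -> : rev (iota 0 n) = [seq (n - i.+1)%N | i <- iota 0 n].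
    apply: (@eq_from_nth _ 0%N) => [|i]; rewrite size_rev ?size_map size_iota // => lt_in.
    have lt_rev : (n - i.+1 < n)%N by lia.
    by rewrite (nth_map 0%N) ?nth_rev ?size_iota // !nth_iota.
  rewrite -!map_comp; apply/eq_in_map => i; rewrite mem_iota add0n => /andP[_ lt_in].
  by rewrite /= /f /form_basis; congr (g * (_ * _ ^+ _ * 'X^_)); lia.
apply: wedge_triangular => [i j lt_ji|i]; rewrite /f mulrA coefMXn.
  by rewrite lt_ji.
rewrite ltnn subnn -!horner_coef0 in g0 *.
by rewrite !hornerE /= g0 !expr0n /= ?addr0 ?subr0 ?expr1n; ring.
Qed.

Theorem theorem4 (F : fieldType) (n : nat) (hn : (0 < n)%N)
    (mu : n.-tuple nat) (hmu : sorted geq mu) :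
  (forall (x y s t : 'I_n -> F) (z0 : F), nonzero_params x y s t z0 ->
     htsasm_sum x y s t z0 (staircase n) =
     \prod_(i < n) (1 + z0 * s i * x i) *
     \prod_(i < n) \prod_(j < n | (i < j)%N)
       ((1 + s i * s j * x i * x j) * (1 + s i * t j * x i * (y j)^-1)))
  /\
  exists Phi : 'rV[F]_(n + 1 + n) -> F,
    (forall (sigma : 'S_(n + 1 + n)) (v : 'rV[F]_(n + 1 + n)),
       Phi (col_perm sigma v) = Phi v)
    /\
    (forall (x y s t : 'I_n -> F) (z0 : F), nonzero_params x y s t z0 ->
       htsasm_sum x y s t z0 (add_staircase mu) =
       htsasm_sum x y s t z0 (staircase n) * Phi (zvec x y s t z0)).
Proof.
have staircase_sum (x y s t : 'I_n -> F) z0 : nonzero_params x y s t z0 ->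
    htsasm_sum x y s t z0 (staircase n)
    = product_formula z0 [seq (s i * x i, t i * (y i)^-1) | i <- enum 'I_n].
  case=> nz _; have y_neq0 i : y i != 0 by have [] := nz i.
  have headE : head 0%N (staircase n) = n.
    by case: n hn {mu hmu x y s t nz y_neq0} => // k _; rewrite /= enum_ordSl.
  rewrite htsasm_sumE // wedge_staircase ?mulr1 //.
  (* As n > 0, each geometric series has constant term 1. *)
  rewrite -horner_coef0 horner_prod big1 // => i _.
  by rewrite horner_coef0 coef_poly headE hn expr0.
split=> [x y s t z0 nz|].
  rewrite staircase_sum // product_formulaE; congr (_ * _).
    by apply: eq_bigr => i _; rewrite mulrA.
  by apply: eq_bigr => i _; apply: eq_bigr => j _; congr (_ * _); ring.
pose m := head 0%N (add_staircase mu).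
(* The coefficient sees the variables only through a product over all of them, hence is symmetric.
   It is the required ratio because the same coefficient for the staircase is 1. *)
exists (fun v => coef_state (part_state m (add_staircase mu))
  (wedge (\prod_i geom m (v 0 i)) (form_bases F n) (vacuum F m))); split.
  move=> sigma v; rewrite [in RHS](reindex_inj (@perm_inj _ sigma)).
  by under eq_bigr => i _ do rewrite mxE.
move=> x y s t z0 nz; rewrite staircase_sum // htsasm_sumE // => i.
by have [/(_ i)[]] := nz.
Qed.
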